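(* Let $\gamma=\{\gamma_{ij}\}_{i,j\ge0}$ be a recursive sequence of Fibonacci type (RSFT). Then the set $\mathcal{A}_\gamma$ of analytic characteristic polynomials of $\gamma$ is a principal ideal of $\mathbb{C}[X]$.
   Context: RSFT: a sequence $\gamma=\{\gamma_{ij}\}_{i,j\ge0}$ of complex numbers with $\gamma_{00}>0$, $\gamma_{ji}=\overline{\gamma_{ij}}$ for all $i,j$, for which there are $r\ge1$ and $a_0,\dots,a_{r-1}\in\mathbb{C}$ such that $\gamma_{i,n+1}=a_0\gamma_{i,n}+a_1\gamma_{i,n-1}+\dots+a_{r-1}\gamma_{i,n-r+1}$ for all $i\ge0$ and $n\ge r-1$ (one says $P(x)=x^r-a_0x^{r-1}-\dots-a_{r-1}$ is an analytic characteristic polynomial of $\gamma$). $\mathcal{A}_\gamma$ is the set of all $q=\sum_k q_kX^k\in\mathbb{C}[X]$ such that $\sum_kq_k\gamma_{i,j+k}=0$ for all $i,j\ge0$. *)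

(* Defs.v *)
From mathcomp Require Import all_boot all_order all_algebra.
From mathcomp Require Import classical_sets reals.
From mathcomp Require Import complex.

Set Implicit Arguments.
Unset Strict Implicit.
Unset Printing Implicit Defensive.

Import Order.TTheory GRing.Theory Num.Theory.
Local Open Scope ring_scope.
Local Open Scope classical_set_scope.

(* Ideals of a commutative ring, as classical sets.  The structure [idealr] of
   [ring_quotient] is not used: it only covers decidable and proper ideals. *)
Definition is_ideal (A : comNzRingType) (I : set A) : Prop :=
  [/\ I 0,
      forall u v : A, I u -> I v -> I (u + v) &
      forall a u : A, I u -> I (a * u)].

Definition is_principal_ideal (A : comNzRingType) (I : set A) : Prop :=
  is_ideal I /\ exists g : A, I = range (fun p : A => g * p).

(* On [R[i]], [0 < z] says that [z] is real and positive.  The truncated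
   subtraction [n - k] is exact, since [k <= r.-1 <= n]. *)
Definition RSFT (R : realType) (gamma : nat -> nat -> R[i]) : Prop :=
  [/\ 0 < gamma 0%N 0%N,
      forall i j : nat, gamma j i = (gamma i j)^* &
      exists (r : nat) (a : 'I_r -> R[i]),
        (0 < r)%N /\
        forall i n : nat, (r.-1 <= n)%N ->
          gamma i n.+1 = \sum_(k < r) a k * gamma i (n - k)%N].

Definition analytic_char_set (R : realType) (gamma : nat -> nat -> R[i]) :
    set {poly R[i]} :=
  [set q | forall i j : nat,
     \sum_(k < size q) q`_k * gamma i (j + k)%N = 0].

(* Main.v *)
Require Import Defs.
From mathcomp Require Import all_boot all_order all_algebra.
From mathcomp Require Import boolp classical_sets reals complex.

(* [A_gamma] is stable under multiplication by constants and by ['X] (which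
   merely shifts the index [j]), hence an ideal, and a nonzero ideal of the
   polynomials over a field is generated by any nonzero element of least
   degree. *)

Set Implicit Arguments.
Unset Strict Implicit.
Unset Printing Implicit Defensive.

Import GRing.Theory.
Local Open Scope ring_scope.
Local Open Scope classical_set_scope.

Lemma poly_ideal_principal (F : fieldType) (I : set {poly F}) :
  is_ideal I -> is_principal_ideal I.
Proof.
move=> idI; split=> //; have [I0 ID IM] := idI.
have [allI0|nzI] := pselect (forall u, I u -> u = 0).
  exists 0; apply/seteqP; split=> [u /allI0 ->|_ [p _ <-]].
    by exists 0; rewrite ?mul0r.
  by rewrite mul0r.
(* [ex_minnP] minimises over a boolean predicate; membership in [I] is only a [Prop], hence the
   reflection [[< _ >]]. *)
have exn : exists n, `[< exists2 g, I g & g != 0 /\ size g = n >].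
  apply: contrapT => noI; apply: nzI => u Iu; apply: contrapT => /eqP u0.
  by apply: noI; exists (size u); apply/asboolP; exists u.
case: (ex_minnP exn) => _ /asboolP [g Ig [g0 <-]] ming.
exists g; apply/seteqP; split=> [u Iu|_ [p _ <-]]; last by rewrite mulrC; apply: IM.
exists (u %/ g) => //; rewrite mulrC.
(* The remainder is a combination of [u] and [g], so it stays in [I]; being smaller than [g], it
   vanishes by minimality. *)
have Imod : I (u %% g).
  have -> : u %% g = u + - (u %/ g) * g.
    by rewrite {2}(divp_eq u g) mulNr addrAC subrr add0r.
  by apply: ID => //; apply: IM.
have [mod0|modN0] := eqVneq (u %% g) 0; first by rewrite [RHS](divp_eq u g) mod0 addr0.
have /ming : `[< exists2 h, I h & h != 0 /\ size h = size (u %% g) >].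
  by apply/asboolP; exists (u %% g).
by rewrite leqNgt ltn_modp g0.
Qed.

(** Coefficients past the size are zero. Sums attached to different polynomials can thus be compared
    over one range, given only upper bounds on the sizes. *)
Lemma poly_coef_sum_widen (A : nzRingType) (q : {poly A}) (f : nat -> A) n :
  (size q <= n)%N ->
  \sum_(k < size q) q`_k * f k = \sum_(k < n) q`_k * f k.
Proof.
move=> le_qn; rewrite (big_ord_widen n (fun k => q`_k * f k) le_qn) big_mkcond.
apply: eq_bigr => k _; case: ltnP => // le_qk.
by rewrite nth_default ?mul0r.
Qed.

Section AnalyticCharSet.

Variables (R : realType) (gamma : nat -> nat -> R[i]).
Implicit Types a u v : {poly R[i]}.

Lemma analytic_char_set0 : analytic_char_set gamma 0.
Proof. by move=> i j; rewrite size_poly0 big_ord0. Qed.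

Lemma analytic_char_setD u v :
  analytic_char_set gamma u -> analytic_char_set gamma v ->
  analytic_char_set gamma (u + v).
Proof.
move=> Iu Iv i j; pose f k := gamma i (j + k)%N.
pose n := maxn (size u) (size v).
have := Iu i j; rewrite (poly_coef_sum_widen f (leq_maxl _ _ : (_ <= n)%N)) => u0.
have := Iv i j; rewrite (poly_coef_sum_widen f (leq_maxr _ _ : (_ <= n)%N)) => v0.
rewrite (poly_coef_sum_widen f (size_polyD u v)).
under eq_bigr do rewrite coefD mulrDl.
by rewrite big_split /= u0 v0 addr0.
Qed.

Lemma analytic_char_setZ (c : R[i]) u :
  analytic_char_set gamma u -> analytic_char_set gamma (c *: u).
Proof.
move=> Iu i j; pose f k := gamma i (j + k)%N.
(* A bound on the size suffices, so [c = 0] needs no separate case. *)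
rewrite (poly_coef_sum_widen f (size_scale_leq c u)).
under eq_bigr do rewrite coefZ -mulrA.
by rewrite -mulr_sumr Iu mulr0.
Qed.

Lemma analytic_char_setMX u :
  analytic_char_set gamma u -> analytic_char_set gamma (u * 'X).
Proof.
move=> Iu i j; pose f k := gamma i (j + k)%N.
have size_uX : (size (u * 'X)%R <= (size u).+1)%N.
  by apply: leq_trans (size_polyMleq _ _) _; rewrite size_polyX addn2.
rewrite (poly_coef_sum_widen f size_uX) big_ord_recl coefMX mul0r add0r.
rewrite -[RHS](Iu i j.+1); apply: eq_bigr => k _.
by rewrite coefMX /f /= addSnnS.
Qed.

Lemma analytic_char_set_ideal : is_ideal (analytic_char_set gamma).
Proof.
split; [exact: analytic_char_set0|exact: analytic_char_setD|].
move=> a u Iu; elim/poly_ind: a => [|a c IHa].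
  by rewrite mul0r; apply: analytic_char_set0.
(* Horner step: [(a * 'X + c%:P) * u = (a * u) * 'X + c *: u]. *)
rewrite mulrDl mul_polyC mulrAC.
by apply: analytic_char_setD; [apply: analytic_char_setMX|apply: analytic_char_setZ].
Qed.

End AnalyticCharSet.

Theorem proposition9 (R : realType) (gamma : nat -> nat -> R[i]) :
  RSFT gamma -> is_principal_ideal (analytic_char_set gamma).
Proof. by move=> _; apply/poly_ideal_principal/analytic_char_set_ideal. Qed.
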